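(* Let $G$ be a finite connected vertex-weighted graph and $\delta$ a special divisor class on $G$. Then $\delta$ contains a representative $\underline{d}$ such that for all vertices $v\in V(G)$ we have \[-1\le \underline{d}_v\le 2g_v-2+\mathrm{val}(v).\] Furthermore, $\underline{d}_v=-1$ is only possible if $g_v=0$ and there is no loop adjacent to $v$.
   Context: $G$ is a finite connected graph with vertex set $V(G)$, multiple edges and loops allowed; each vertex $v$ carries a weight $g_v\in\mathbb{Z}_{\ge 0}$. The valence $\mathrm{val}(v)$ is the number of edges adjacent to $v$, with loops counted twice. A divisor is a formal sum $\underline{d}=\sum_{v\in V(G)}\underline{d}_v\, v$ with $\underline{d}_v\in\mathbb{Z}$; it is effective if all $\underline{d}_v\ge 0$. For $f:V(G)\to\mathbb{Z}$, $\mathrm{div}(f)$ is the divisor with $\mathrm{div}(f)_v=\sum_{e=vw}(f(w)-f(v))$, the sum over all edges $e$ adjacent to $v$ (loops contribute $0$). Two divisors are linearly equivalent if they differ by $\mathrm{div}(f)$ for some $f:V(G)\to\mathbb{Z}$; a divisor class is a linear equivalence class, and it is effective if it contains an effective divisor. The canonical divisor $\underline{k}$ has $\underline{k}_v=2g_v-2+\mathrm{val}(v)$, and its class is $\omega$. The residual class of $\delta$ is $\delta^*=\omega-\delta$, i.e. the class of $\underline{k}-\underline{d}$ for any $\underline{d}\in\delta$. A divisor class $\delta$ is special if both $\delta$ and $\delta^*$ are effective. *)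

(* Defs.v *)
From mathcomp Require Import all_boot all_order all_algebra.

Set Implicit Arguments.
Unset Strict Implicit.
Unset Printing Implicit Defensive.

Import Order.TTheory GRing.Theory Num.Theory.
Local Open Scope ring_scope.

(* Edges form a type of their own, so multiple edges and loops are allowed.
   An edge is undirected: the labels src/tgt only name its two ends, and
   every notion below is invariant under swapping them. *)
Record wgraph := WGraph {
  vertex : finType;
  edge : finType;
  src : edge -> vertex;
  tgt : edge -> vertex;
  weight : vertex -> nat
}.

Section Graph.

Variable G : wgraph.
Implicit Types (v w : vertex G) (e : edge G).

Definition incident e v : bool := (src e == v) || (tgt e == v).

Definition is_loop e : bool := src e == tgt e.

(* Meaningful only when [incident e v]; for a loop at v it is v itself. *)
Definition other_end e v : vertex G := if src e == v then tgt e else src e.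

Definition adjacent : rel (vertex G) :=
  fun v w => [exists e, incident e v && (other_end e v == w)].

(* The empty graph is not connected. *)
Definition connected_graph : Prop :=
  (0 < #|vertex G|)%N /\ forall v w, connect adjacent v w.

Definition valence v : nat :=
  (\sum_(e : edge G | incident e v) (if is_loop e then 2 else 1))%N.

Definition divisor : Type := {ffun vertex G -> int}.

Definition effective (d : divisor) : Prop := forall v, 0 <= d v.

Definition div_of (f : {ffun vertex G -> int}) : divisor :=
  [ffun v => \sum_(e : edge G | incident e v) (f (other_end e v) - f v)].

Definition canonical_div : divisor :=
  [ffun v => 2 * (weight v)%:Z - 2 + (valence v)%:Z].

Definition lin_equiv (d d' : divisor) : Prop :=
  exists f : {ffun vertex G -> int}, d' - d = div_of f.

(* Divisor classes are represented as predicates on divisors. *)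
Definition class_of (d : divisor) : divisor -> Prop := lin_equiv d.

Definition is_divisor_class (delta : divisor -> Prop) : Prop :=
  exists d, forall d', delta d' <-> class_of d d'.

Definition effective_class (delta : divisor -> Prop) : Prop :=
  exists2 d, delta d & effective d.

(* The union over d in delta of the classes of canonical_div - d; these all
   coincide when delta is a class, see [residualE]. *)
Definition residual (delta : divisor -> Prop) : divisor -> Prop :=
  fun d' => exists2 d, delta d & class_of (canonical_div - d) d'.

Definition special (delta : divisor -> Prop) : Prop :=
  [/\ is_divisor_class delta, effective_class delta
    & effective_class (residual delta)].

Lemma div_ofB f h : div_of (f - h) = div_of f - div_of h.
Proof.
apply/ffunP => v; rewrite !ffunE -sumrB; apply: eq_bigr => e _.
by rewrite !ffunE !opprD !opprK addrACA.
Qed.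

Lemma lin_equiv_refl d : lin_equiv d d.
Proof. by exists 0; rewrite -[X in div_of X](subrr 0) div_ofB !subrr. Qed.

Lemma lin_equiv_sym d d' : lin_equiv d d' -> lin_equiv d' d.
Proof.
have [f0 f0E] := lin_equiv_refl d.
by case=> f df; exists (f0 - f); rewrite div_ofB -df -f0E subrr sub0r opprB.
Qed.

Lemma lin_equiv_trans d1 d2 d3 :
  lin_equiv d1 d2 -> lin_equiv d2 d3 -> lin_equiv d1 d3.
Proof.
move=> /lin_equiv_sym [f df] [h dh]; exists (h - f).
by rewrite div_ofB -df -dh opprB addrA subrK.
Qed.

Lemma residualE (delta : divisor -> Prop) d :
  is_divisor_class delta -> delta d ->
  forall d', residual delta d' <-> class_of (canonical_div - d) d'.
Proof.
move=> [d0 d0P] dd d'; split; last by move=> ?; exists d.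
case=> d1 /d0P d01 d1d'; apply: lin_equiv_trans d1d'.
have [f df] := lin_equiv_trans (lin_equiv_sym d01) ((d0P d).1 dd).
by exists f; rewrite -df opprB addrC addrA subrK.
Qed.

End Graph.

(* Main.v *)
Require Import Defs.
From mathcomp Require Import all_boot all_order all_algebra.
From mathcomp Require Import zify.
Import Order.TTheory GRing.Theory Num.Theory.
Local Open Scope ring_scope.

Set Implicit Arguments.
Unset Strict Implicit.

(** Start from an effective divisor [d] of the class and fire, one at a time,
    any vertex [v] with [d v > 2 g_v - 2 + val v].  Firing [v] costs it
    [val v - 2 #(loops at v)] chips, so it keeps at least
    [2 g_v - 1 + 2 #(loops at v)], while no other vertex loses chips: this
    preserves the lower bound and the condition for [-1].  The process stops by
    a least action argument: the residual class being effective, there is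
    [f >= 0] with [d + div f <= k], and each vertex [v] is fired at most [f v]
    times. *)

Section Firing.

Variable G : wgraph.
Implicit Types (d : divisor G) (f : {ffun vertex G -> int}) (u v : vertex G).

(* [ffunE] would leave values whose type is only convertible to [int], which
   [lia] does not recognize. *)
Lemma divisorDE d1 d2 v : (d1 + d2) v = d1 v + d2 v :> int.
Proof. by rewrite ffunE. Qed.

Lemma divisorBE d1 d2 v : (d1 - d2) v = d1 v - d2 v :> int.
Proof. by rewrite !ffunE. Qed.

Definition indicator u : {ffun vertex G -> int} := [ffun v => (v == u)%:Z].

Lemma sum_indicator u : \sum_v indicator u v = 1.
Proof.
rewrite (bigD1 u) //= ffunE eqxx big1 ?addr0 // => v /negPf vu.
by rewrite ffunE vu.
Qed.

Definition almost_effective d : Prop :=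
  forall v, -1 <= d v /\
    (d v = -1 -> weight v = 0%N /\
                 ~ exists e : edge G, is_loop e /\ incident e v).

Definition loop_count v : nat := #|[pred e : edge G | incident e v && is_loop e]|.

Lemma loop_count_eq0 v :
  loop_count v = 0%N -> ~ exists e : edge G, is_loop e /\ incident e v.
Proof.
by move=> /card0_eq no_loop [e [el ev]]; have := no_loop e; rewrite !inE ev el.
Qed.

Lemma div_of_const (c : int) : div_of [ffun _ : vertex G => c] = 0.
Proof. by apply/ffunP => v; rewrite !ffunE big1 // => e _; rewrite !ffunE subrr. Qed.

Lemma div_of_ge0_at_min f v : (forall w, f v <= f w) -> 0 <= div_of f v.
Proof. by move=> fmin; rewrite ffunE sumr_ge0 // => e _; rewrite subr_ge0. Qed.

Lemma div_of_indicator_neq u v : v != u -> 0 <= div_of (indicator u) v.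
Proof.
by move=> /negPf vu; apply: div_of_ge0_at_min => w; rewrite !ffunE vu.
Qed.

(** Edge by edge: a non-loop at [u] contributes [-1 = 0 - 1], and a loop [0 = 2 - 2], since
    [valence] counts it twice. *)
Lemma div_of_indicator u :
  div_of (indicator u) u = 2 * (loop_count u)%:Z - (valence u)%:Z.
Proof.
have -> : (valence u)%:Z
    = \sum_(e : edge G | incident e u) (if is_loop e then 2 else 1 : int).
  rewrite /valence (big_morph Posz PoszD (erefl 0%:Z)).
  by apply: eq_bigr => e _; case: ifP.
have -> : 2 * (loop_count u)%:Z
    = \sum_(e : edge G | incident e u) (if is_loop e then 2 else 0 : int).
  by rewrite -big_mkcondr sumr_const -[2 *+ _]mulr_natr !natz.
rewrite ffunE -sumrB; apply: eq_bigr => e.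
rewrite !ffunE eqxx /incident /other_end /is_loop.
by case: (eqVneq (src e) u) => [->|/negPf su] /=; [rewrite eq_sym; case: eqP|
  move=> /eqP ->; rewrite su].
Qed.

Lemma almost_effective_fire d u :
    almost_effective d -> canonical_div G u < d u ->
  almost_effective (d + div_of (indicator u)).
Proof.
move=> dP du v; rewrite divisorDE; have [->|vu] := eqVneq v u.
  rewrite div_of_indicator; move: du; rewrite ffunE => du.
  split=> [|dE]; first by lia.
  (* The new value is at least [2 * weight u - 1 + 2 * loop_count u], so [-1] forces both terms to
     vanish. *)
  by split; [|apply: loop_count_eq0]; lia.
have [d1 dN1] := dP v; have := div_of_indicator_neq vu.
split=> [|dE]; first by lia.
by apply: dN1; lia.
Qed.

(** Induction on a strict bound for the sum of [f], which records the firings still allowed: firing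
    [u] replaces [f] by [f - indicator u] and leaves [d + div_of f] unchanged. *)
Lemma fire_below_canonical d f :
    almost_effective d -> (forall v, 0 <= f v) ->
    (forall v, (d + div_of f) v <= canonical_div G v) ->
  exists2 d', lin_equiv d d' &
    almost_effective d' /\ forall v, d' v <= canonical_div G v.
Proof.
have [n] : exists n : nat, \sum_v f v < n%:Z.
  by exists `|\sum_v f v|.+1; lia.
elim: n d f => [|n IHn] d f fn dP f0 dfP.
  by move: fn; rewrite ltNge sumr_ge0.
have [/forallP dk|/forallPn[u]] :=
  boolP [forall v, d v <= canonical_div G v].
  by exists d; first exact: lin_equiv_refl.
rewrite -ltNge => du.
(* If [f u = 0], then [u] minimizes [f], so [div_of f] is nonnegative at [u] and [d u] is already at
   most the canonical value. *)
have fu : 0 < f u.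
  rewrite lt_neqAle f0 andbT; apply/eqP => fu0.
  have : 0 <= div_of f u by apply: div_of_ge0_at_min => w; rewrite -fu0.
  by have := dfP u; rewrite divisorDE; lia.
have [||||d' dd' d'P] := IHn (d + div_of (indicator u)) (f - indicator u).
- rewrite (eq_bigr (fun v => f v - indicator u v)) => [|v _]; last first.
    exact: divisorBE.
  by rewrite sumrB sum_indicator ltrBlDr -PoszD addn1.
- exact: almost_effective_fire.
- move=> v; rewrite divisorBE ffunE; have := f0 v.
  by case: eqVneq => [->|_] /=; lia.
- by move=> v; rewrite div_ofB addrA addrAC addrK.
exists d' => //; apply: lin_equiv_trans dd'.
by exists (indicator u); rewrite addrC addKr.
Qed.

End Firing.

Theorem theoremB (G : wgraph) (delta : divisor G -> Prop) :
  connected_graph G -> special delta ->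
  exists d : divisor G,
    [/\ delta d,
        forall v : vertex G,
          -1 <= d v /\ d v <= 2 * (weight v)%:Z - 2 + (valence v)%:Z
      & forall v : vertex G, d v = -1 ->
          weight v = 0%N /\
          ~ (exists e : edge G, is_loop e /\ incident e v)].
Proof.
move=> _ [delta_class [d dd d0] [e /(residualE delta_class dd) ke e0]].
have [f fE] := lin_equiv_sym ke.
(* Adding the constant [c], which bounds every [-f v], makes [f] nonnegative without changing
   [div_of f]. *)
pose c := \sum_v `|f v|.
pose h := f - [ffun=> - c].
have h0 v : 0 <= h v.
  rewrite divisorBE ffunE opprK /c (bigD1 v) //= addrA.
  by apply: addr_ge0; [lia | apply: sumr_ge0].
have dP : almost_effective d by move=> v; have := d0 v; split; lia.
(* Here [d + div_of h] equals [canonical_div G - e], with [e] effective. *)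
have dhP v : (d + div_of h) v <= canonical_div G v.
  rewrite div_ofB div_of_const subr0 -fE.
  have -> : d + (canonical_div G - d - e) = canonical_div G - e.
    by rewrite addrA [d + _]addrC subrK.
  by have := e0 v; rewrite divisorBE; lia.
have [d' dd' [d'P d'k]] := fire_below_canonical dP h0 dhP.
exists d'; split=> [|v|v].
- case: delta_class => d1 d1P; apply/d1P.
  exact: lin_equiv_trans ((d1P d).1 dd) dd'.
- by split; [have [] := d'P v | have := d'k v; rewrite ffunE].
- by have [] := d'P v.
Qed.
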